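(* (3D generalized LF splitting.) Let $Q\ge1$, let $\Delta x,\Delta y,\Delta z>0$, and let $\omega_1,\dots,\omega_Q>0$ with $\sum_{i=1}^Q\omega_i=1$. If $\bar{\mathbf U}^i,\tilde{\mathbf U}^i,\hat{\mathbf U}^i,\check{\mathbf U}^i,\acute{\mathbf U}^i,\grave{\mathbf U}^i\in\mathcal G$ for $i=1,\dots,Q$ satisfy the 3D discrete divergence-free condition $$\frac{\sum_{i=1}^Q\omega_i(\bar B_1^i-\tilde B_1^i)}{\Delta x}+\frac{\sum_{i=1}^Q\omega_i(\hat B_2^i-\check B_2^i)}{\Delta y}+\frac{\sum_{i=1}^Q\omega_i(\acute B_3^i-\grave B_3^i)}{\Delta z}=0,$$ then for any $\alpha_1^{LF},\alpha_2^{LF},\alpha_3^{LF}$ satisfying $$\alpha_1^{LF}>\max_{1\le i\le Q}\alpha_1(\bar{\mathbf U}^i,\tilde{\mathbf U}^i),\quad \alpha_2^{LF}>\max_{1\le i\le Q}\alpha_2(\hat{\mathbf U}^i,\check{\mathbf U}^i),\quad \alpha_3^{LF}>\max_{1\le i\le Q}\alpha_3(\acute{\mathbf U}^i,\grave{\mathbf U}^i),$$ it holds that $\overline{\mathbf U}\in\mathcal G$, where $$\overline{\mathbf U}:=\frac{1}{2\big(\frac{\alpha_1^{LF}}{\Delta x}+\frac{\alpha_2^{LF}}{\Delta y}+\frac{\alpha_3^{LF}}{\Delta z}\big)}\sum_{i=1}^Q\omega_i\Big[\frac{\alpha_1^{LF}}{\Delta x}\Big(\bar{\mathbf U}^i-\frac{\mathbf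 F_1(\bar{\mathbf U}^i)}{\alpha_1^{LF}}+\tilde{\mathbf U}^i+\frac{\mathbf F_1(\tilde{\mathbf U}^i)}{\alpha_1^{LF}}\Big)+\frac{\alpha_2^{LF}}{\Delta y}\Big(\hat{\mathbf U}^i-\frac{\mathbf F_2(\hat{\mathbf U}^i)}{\alpha_2^{LF}}+\check{\mathbf U}^i+\frac{\mathbf F_2(\check{\mathbf U}^i)}{\alpha_2^{LF}}\Big)+\frac{\alpha_3^{LF}}{\Delta z}\Big(\acute{\mathbf U}^i-\frac{\mathbf F_3(\acute{\mathbf U}^i)}{\alpha_3^{LF}}+\grave{\mathbf U}^i+\frac{\mathbf F_3(\grave{\mathbf U}^i)}{\alpha_3^{LF}}\Big)\Big].$$
   Context: A state is $\mathbf U=(\rho,\mathbf m,\mathbf B,E)^\top\in\mathbb R^8$ with $\rho,E\in\mathbb R$, $\mathbf m,\mathbf B\in\mathbb R^3$; accents and superscripts on components (e.g. $\bar B_1^i$) refer to the state carrying them. For $\rho>0$ put $\mathbf v=\mathbf m/\rho$, $\mathcal E(\mathbf U)=E-\frac12\big(\frac{|\mathbf m|^2}{\rho}+|\mathbf B|^2\big)$, $e=\mathcal E(\mathbf U)/\rho$, $p=p(\rho,e)$, $p_{tot}=p+\frac{|\mathbf B|^2}{2}$. The equation of state $p(\rho,e)$ is any function such that, whenever $\rho>0$, one has $e>0\Leftrightarrow p(\rho,e)>0$. Admissible states: $\mathcal G=\{\mathbf U:\rho>0,\ \mathcal E(\mathbf U)>0\}$. Flux: $$\mathbf F_i(\mathbf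 U)=\big(\rho v_i,\ \rho v_i\mathbf v-B_i\mathbf B+p_{tot}\mathbf e_i,\ v_i\mathbf B-B_i\mathbf v,\ v_i(E+p_{tot})-B_i(\mathbf v\cdot\mathbf B)\big)^\top,$$ with $\mathbf e_i$ the $i$-th standard unit vector of $\mathbb R^3$. For $\mathbf U,\tilde{\mathbf U}\in\mathcal G$, $\alpha_i(\mathbf U,\tilde{\mathbf U})=\min_{\sigma\in\mathbb R}\alpha_i(\mathbf U,\tilde{\mathbf U};\sigma)$ with $$\alpha_i(\mathbf U,\tilde{\mathbf U};\sigma)=\max\big\{|v_i|+\mathscr C_i,\ |\tilde v_i|+\tilde{\mathscr C}_i,\ |\sigma v_i+(1-\sigma)\tilde v_i|+\max\{\mathscr C_i,\tilde{\mathscr C}_i\}\big\}+\frac{|\tilde{\mathbf B}-\mathbf B|}{\sqrt2}\sqrt{\frac{\sigma^2}{\rho}+\frac{(1-\sigma)^2}{\tilde\rho}},$$ $$\mathscr C_i=\frac1{\sqrt2}\Big[\mathscr C_s^2+\frac{|\mathbf B|^2}{\rho}+\sqrt{\Big(\mathscr C_s^2+\frac{|\mathbf B|^2}{\rho}\Big)^2-4\frac{\mathscr C_s^2B_i^2}{\rho}}\Big]^{1/2},\qquad \mathscr C_s=\frac{p}{\rho\sqrt{2e}},$$ and $\tilde{\mathscr C}_i$ the same quantity for $\tilde{\mathbf U}$. *)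

(* Defs.v *)
From HB Require Import structures.
From mathcomp Require Import all_boot all_order all_algebra.
From mathcomp Require Import all_classical all_reals all_analysis.
From mathcomp Require Import ring.
Set Implicit Arguments.
Unset Strict Implicit.
Unset Printing Implicit Defensive.
Import Order.TTheory GRing.Theory Num.Theory numFieldNormedType.Exports.
Local Open Scope ring_scope.

(* A state of R^8 is stored as (rho, m, B, E), in blocks of size 1, 3, 3, 1. *)
Notation state R := 'rV[R]_(1 + (3 + (3 + 1))).

Definition axis1 : 'I_3 := @Ordinal 3 0 isT.
Definition axis2 : 'I_3 := @Ordinal 3 1 isT.
Definition axis3 : 'I_3 := @Ordinal 3 2 isT.

Section Vectors.
Variable R : realType.

Definition dotv (u v : 'rV[R]_3) : R := \sum_(k < 3) u 0 k * v 0 k.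

(* The library norm on row vectors is the maximum norm, hence this one. *)
Definition enorm (u : 'rV[R]_3) : R := Num.sqrt (dotv u u).

End Vectors.

Section Components.
Variable R : realType.
Implicit Type U : state R.

Definition mkstate (rho : R) (m B : 'rV[R]_3) (E : R) : state R :=
  row_mx rho%:M (row_mx m (row_mx B E%:M)).

Definition density U : R := (lsubmx U) 0 0.
Definition momentum U : 'rV[R]_3 := lsubmx (rsubmx U).
Definition magnetic U : 'rV[R]_3 := lsubmx (rsubmx (rsubmx U)).
Definition energy U : R := (rsubmx (rsubmx (rsubmx U))) 0 0.

Lemma density_mkstate rho m B E : density (mkstate rho m B E) = rho.
Proof. by rewrite /density row_mxKl mxE eqxx mulr1n. Qed.

Lemma momentum_mkstate rho m B E : momentum (mkstate rho m B E) = m.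
Proof. by rewrite /momentum row_mxKr row_mxKl. Qed.

Lemma magnetic_mkstate rho m B E : magnetic (mkstate rho m B E) = B.
Proof. by rewrite /magnetic !row_mxKr row_mxKl. Qed.

Lemma energy_mkstate rho m B E : energy (mkstate rho m B E) = E.
Proof. by rewrite /energy !row_mxKr mxE eqxx mulr1n. Qed.

Definition velocity U : 'rV[R]_3 := (density U)^-1 *: momentum U.

Definition internal_energy U : R :=
  energy U - 2^-1 * (enorm (momentum U) ^+ 2 / density U
                     + enorm (magnetic U) ^+ 2).

Definition specific_energy U : R := internal_energy U / density U.

Definition admissible U : Prop := 0 < density U /\ 0 < internal_energy U.

End Components.

Definition valid_eos (R : realType) (p : R -> R -> R) : Prop :=
  forall rho e : R, 0 < rho -> (0 < e <-> 0 < p rho e).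

Section MHD.
Variables (R : realType) (p : R -> R -> R).
Implicit Types (U V : state R) (i : 'I_3) (s : R).

Definition pressure U : R := p (density U) (specific_energy U).

Definition total_pressure U : R := pressure U + enorm (magnetic U) ^+ 2 / 2.

Definition flux i U : state R :=
  let v := velocity U in
  let B := magnetic U in
  let ptot := total_pressure U in
  mkstate (density U * v 0 i)
          ((density U * v 0 i) *: v - B 0 i *: B + ptot *: delta_mx 0 i)
          (v 0 i *: B - B 0 i *: v)
          (v 0 i * (energy U + ptot) - B 0 i * dotv v B).

Definition sound_speed U : R :=
  pressure U / (density U * Num.sqrt (2 * specific_energy U)).

Definition fast_speed i U : R :=
  let c2 := sound_speed U ^+ 2 in
  let a := c2 + enorm (magnetic U) ^+ 2 / density U in
  (Num.sqrt 2)^-1 *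
  Num.sqrt (a + Num.sqrt (a ^+ 2 - 4 * (c2 * magnetic U 0 i ^+ 2 / density U))).

Definition alpha_at i U V s : R :=
  let vU := velocity U 0 i in
  let vV := velocity V 0 i in
  let cU := fast_speed i U in
  let cV := fast_speed i V in
  Num.max (`|vU| + cU)
    (Num.max (`|vV| + cV) (`|s * vU + (1 - s) * vV| + Num.max cU cV))
  + enorm (magnetic V - magnetic U) / Num.sqrt 2
    * Num.sqrt (s ^+ 2 / density U + (1 - s) ^+ 2 / density V).

(* The minimum over all s: [alpha_attained] below shows that it is attained. *)
Definition alpha i U V : R := inf (range (alpha_at i U V)).

Let alpha_at_continuous i U V : continuous (alpha_at i U V).
Proof.
move=> s; rewrite /alpha_at.
have lin (a b : R) : {for s, continuous (fun t : R => t * a + (1 - t) * b)}.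
  apply: cvgD; first by apply: cvgM; [exact: cvg_id|exact: cvg_cst].
  by apply: cvgM; [apply: cvgB; [exact: cvg_cst|exact: cvg_id]|exact: cvg_cst].
apply: (@cvgD _ _ _ (nbhs s)).
  apply: (@continuous_max R _ (cst _) _ s); first exact: cvg_cst.
  apply: (@continuous_max R _ (cst _) _ s); first exact: cvg_cst.
  apply: cvgD; last exact: cvg_cst.
  by apply: cvg_norm; exact: lin.
apply: cvgM; first exact: cvg_cst.
apply: (@continuous_comp _ _ _ _ Num.sqrt s); last exact: sqrt_continuous.
have sq (f : R -> R) (a : R) : {for s, continuous f} ->
    {for s, continuous (fun t : R => f t ^+ 2 * a)}.
  move=> fc; apply: cvgM; last exact: cvg_cst.
  by rewrite expr2; under eq_fun do rewrite expr2; exact: cvgM.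
apply: (@cvgD _ _ _ (nbhs s)); first by apply: sq; exact: cvg_id.
by apply: sq; apply: cvgB; [exact: cvg_cst|exact: cvg_id].
Qed.

Lemma alpha_attained i U V : admissible U -> admissible V ->
  exists s, alpha i U V = alpha_at i U V s /\
            forall t, alpha_at i U V s <= alpha_at i U V t.
Proof.
move=> [rU _] [rV _].
suff [s smin] : exists s, forall t, alpha_at i U V s <= alpha_at i U V t.
  exists s; split => //; apply/eqP; rewrite eq_le; apply/andP; split.
    by apply: ge_inf; [exists (alpha_at i U V s) => _ [t _ <-]|exists s].
  by apply: lb_le_inf; [exists (alpha_at i U V s), s|move=> _ [t _ <-]].
pose d := velocity U 0 i - velocity V 0 i.
pose b := enorm (magnetic V - magnetic U) / Num.sqrt 2.
have b0 : 0 <= b by rewrite divr_ge0 ?sqrtr_ge0.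
pose k := `|d| + b / Num.sqrt (density U).
have k0 : 0 <= k by rewrite addr_ge0 // divr_ge0 ?sqrtr_ge0.
have c0 j W : 0 <= fast_speed j W by rewrite mulr_ge0 ?invr_ge0 ?sqrtr_ge0.
have lower t : `|t| * k - `|velocity V 0 i| <= alpha_at i U V t.
  rewrite /alpha_at /= -/b.
  have h1 : `|t| * `|d| - `|velocity V 0 i| <=
      `|t * velocity U 0 i + (1 - t) * velocity V 0 i|.
    have -> : t * velocity U 0 i + (1 - t) * velocity V 0 i
              = t * d - - velocity V 0 i by rewrite /d; ring.
    by rewrite -normrM; apply: le_trans (lerB_dist _ _); rewrite normrN.
  have h2 : `|t| * (b / Num.sqrt (density U)) <=
      b * Num.sqrt (t ^+ 2 / density U + (1 - t) ^+ 2 / density V).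
    rewrite mulrCA ler_wpM2l // -sqrtr_sqr -sqrtrV; last exact: ltW.
    rewrite -sqrtrM ?sqr_ge0 // ler_wsqrtr // lerDl.
    by rewrite divr_ge0 ?sqr_ge0 // ltW.
  rewrite mulrDr addrAC; apply: lerD h2; apply: (le_trans h1).
  rewrite !le_max; apply/orP; right; apply/orP; right.
  by rewrite lerDl le_max c0.
have [k00|kn0] := eqVneq k 0.
  have /andP[/eqP d0 /eqP b00] : (`|d| == 0) && (b == 0).
    move/eqP: k00; rewrite paddr_eq0 ?divr_ge0 ?sqrtr_ge0 //.
    by rewrite mulf_eq0 invr_eq0 sqrtr_eq0 leNgt rU orbF.
  move/normr0_eq0/eqP: d0; rewrite subr_eq0 => /eqP vE.
  exists 0 => t; rewrite /alpha_at /= -/b b00 !mul0r !addr0 vE.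
  have E (x y : R) : x * y + (1 - x) * y = y by ring.
  by rewrite E add0r subr0 mul1r.
have kgt0 : 0 < k by rewrite lt_neqAle eq_sym kn0.
pose M := (`|alpha_at i U V 0| + `|velocity V 0 i|) / k.
have M0 : 0 <= M by apply: divr_ge0 => //; apply: addr_ge0.
have NM : - M <= M by rewrite -subr_ge0 opprK addr_ge0.
have [|s _ smin] := EVT_min (f := alpha_at i U V) NM.
  by apply: continuous_subspaceT; exact: alpha_at_continuous.
exists s => t; have [tM|Mt] := leP `|t| M.
  by apply: smin; rewrite in_itv /= -ler_norml.
apply: (@le_trans _ _ (alpha_at i U V 0)).
  by apply: smin; rewrite in_itv /= oppr_le0 M0.
apply: le_trans (lower t).
move: Mt; rewrite /M ltr_pdivrMr // => /ltW h.
by rewrite lerBrDr; apply: le_trans h; rewrite lerD2r ler_norm.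
Qed.

End MHD.

(* Starting from a member of the family, not from a default such as 0. *)
Definition max_fam (R : realType) (Q : nat) (hQ : (1 <= Q)%N) (f : 'I_Q -> R) :
  R := \big[Num.max/f (Ordinal hQ)]_(i < Q) f i.

(* Main.v *)
Require Import Defs.
From HB Require Import structures.
From mathcomp Require Import all_boot all_order all_algebra.
From mathcomp Require Import all_classical all_reals all_analysis.
From mathcomp Require Import ring lra.
Import Order.TTheory GRing.Theory Num.Theory.
Local Open Scope ring_scope.

(** A state with positive density is admissible exactly when its internal energy
is positive, and internal energy is not linear in the state. The remedy is to
freeze a velocity [v] and a field [B] and to use the functional
[relative_energy v B], which is linear in the state. Where the density is nonzero,
[relative_energy v B U + |B|^2/2] equals the internal energy plus
[(rho |u - v|^2 + |b - B|^2)/2], where [u] and [b] are the velocity and the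
field of [U] ([relative_energyE]). So this quantity, called theta below, is
positive on admissible states, whatever [v] and [B] are; and it is the internal
energy itself when [v] and [B] are the velocity and field of [U]. It is
therefore enough to prove that theta is positive at the average for one
choice of [v] and [B], and there linearity lets each pair of states be treated
on its own.

For a pair [U], [V] in direction [i], the functional of the flux splits
([relative_energy_flux]) into
- the term [B_i(U) (v . B)], which nothing bounds. Its difference over the pair
  is left over, and these left-overs cancel in the weighted sum because of the
  discrete divergence-free condition;
- the term [- v_i |B|^2/2], the same for both states;
- a transport part, essentially [u_i] times theta, with [v_i] in place of [u_i]
  on the magnetic energy [|b - B|^2/2];
- a bilinear work term, bounded by the fast speed times theta: the square of
  the fast speed is the largest eigenvalue of the matrix that governs the term
  ([fast_form_le], [acoustic_work_le]).

As [v_i] may be arbitrarily large, the magnetic part of the transport cannot be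
estimated one state at a time. In the difference over the pair, [v_i] multiplies
[(|b_U - B|^2 - |b_V - B|^2)/2 = (b_U - b_V).(b_U + b_V - 2B)/2]. Writing [v_i]
as [s u_i(U) + (1-s) u_i(V)] minus the same combination of the relative
velocities [u_i - v_i], the first part is a velocity that [alpha_at] contains,
and Cauchy-Schwarz bounds the second by the last term of [alpha_at] times the
sum of the thetas ([magnetic_jump_le]). Hence [flux_difference_le], valid for
every [s], so for the one that attains [alpha]; and any speed strictly above
[alpha] makes the contribution of the pair positive up to the left-over in
[v . B] ([relative_energy_lf_pair_gt0]). *)

(** * The Euclidean dot product *)

Section DotProduct.
Context {R : realType}.
Implicit Types u v w : 'rV[R]_3.

Lemma dotvC u v : dotv u v = dotv v u.
Proof. by apply: eq_bigr => k _; rewrite mulrC. Qed.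

Lemma dotv_is_linear u : linear (dotv u : 'rV[R]_3 -> R^o).
Proof.
move=> a v w; rewrite /dotv scaler_sumr -big_split; apply: eq_bigr => k _.
by rewrite !mxE /= /GRing.scale /=; ring.
Qed.

HB.instance Definition _ u :=
  GRing.isLinear.Build R 'rV[R]_3 R^o *:%R (dotv u) (dotv_is_linear u).

Lemma dotvDr u v w : dotv u (v + w) = dotv u v + dotv u w.
Proof. exact: raddfD. Qed.

Lemma dotvNr u v : dotv u (- v) = - dotv u v.
Proof. exact: raddfN. Qed.

Lemma dotvZr a u v : dotv u (a *: v) = a * dotv u v.
Proof. exact: linearZ. Qed.

Lemma dotvDl u v w : dotv (u + v) w = dotv u w + dotv v w.
Proof. by rewrite !(dotvC _ w) dotvDr. Qed.

Lemma dotvZl a u v : dotv (a *: u) v = a * dotv u v.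
Proof. by rewrite !(dotvC _ v) dotvZr. Qed.

Lemma dotvNl u v : dotv (- u) v = - dotv u v.
Proof. by rewrite !(dotvC _ v) dotvNr. Qed.

Definition dotv_linE :=
  (dotvDl, dotvDr, dotvNl, dotvNr, dotvZl, dotvZr).

Lemma dotv_delta u i : dotv u (delta_mx 0 i) = u 0 i.
Proof.
rewrite /dotv (bigD1 i) //= big1 => [|k ki]; rewrite mxE eqxx /=.
  by rewrite eqxx mulr1 addr0.
by rewrite (negbTE ki) mulr0.
Qed.

Lemma dotv_ge0 u : 0 <= dotv u u.
Proof. by apply: sumr_ge0 => k _; rewrite -expr2 sqr_ge0. Qed.

Lemma enorm_sqr u : enorm u ^+ 2 = dotv u u.
Proof. by rewrite sqr_sqrtr ?dotv_ge0. Qed.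

Lemma coord_sqr_le u i : u 0 i ^+ 2 <= dotv u u.
Proof.
rewrite /dotv (bigD1 i) //= expr2 lerDl.
by apply: sumr_ge0 => k _; rewrite -expr2 sqr_ge0.
Qed.

Lemma cauchy_schwarz u v : dotv u v ^+ 2 <= dotv u u * dotv v v.
Proof.
have := dotv_ge0 (dotv v v *: u - dotv u v *: v).
have [v0|vn0] := eqVneq (dotv v v) 0.
  (* then v = 0, so that u.v = 0 *)
  have vE k : v 0 k = 0.
    by apply/eqP; rewrite -sqrf_eq0 eq_le sqr_ge0 -v0 coord_sqr_le.
  by move=> _; rewrite v0 /dotv big1 ?expr0n ?mulr0 // => k _; rewrite vE mulr0.
have v_gt0 : 0 < dotv v v by rewrite lt_neqAle eq_sym vn0 dotv_ge0.
move=> defect; rewrite -subr_ge0 -(pmulr_rge0 _ v_gt0); move: defect.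
rewrite !dotv_linE (dotvC v u).
by apply: eq_ind; congr (_ <= _); ring.
Qed.

(** Cauchy-Schwarz applied to the components of the two vectors orthogonal to
the [i]-th axis. *)
Lemma cauchy_schwarz_perp u v i :
  (dotv u v - u 0 i * v 0 i) ^+ 2 <=
  (dotv u u - u 0 i ^+ 2) * (dotv v v - v 0 i ^+ 2).
Proof.
have dd : dotv (delta_mx 0 i : 'rV[R]_3) (delta_mx 0 i) = 1.
  by rewrite dotv_delta mxE !eqxx.
have := cauchy_schwarz (u - u 0 i *: delta_mx 0 i) (v - v 0 i *: delta_mx 0 i).
rewrite !dotv_linE dd !(dotvC (delta_mx 0 i)) !dotv_delta.
by apply: eq_ind; congr (_ <= _); ring.
Qed.

End DotProduct.

(** * The fast magnetosonic speed as an eigenvalue bound *)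

Section FastSpeed.
Context {R : realType}.
Implicit Types (W B b : 'rV[R]_3).

Lemma ler_norm_sqr (x y : R) : 0 <= y -> x ^+ 2 <= y ^+ 2 -> `|x| <= y.
Proof. by move=> y0; rewrite -real_normK ?num_real // ler_sqr ?nnegrE. Qed.

Lemma ler_normN (x : R) : - x <= `|x|.
Proof. by rewrite -normrN ler_norm. Qed.

Lemma larger_root (a d l : R) : 0 <= a ^+ 2 - 4 * d ->
  l = (a + Num.sqrt (a ^+ 2 - 4 * d)) / 2 ->
  l ^+ 2 - a * l + d = 0 /\ a <= 2 * l.
Proof.
move=> disc ->; split; last by have := sqrtr_ge0 (a ^+ 2 - 4 * d); lra.
have := sqr_sqrtr disc; set r := Num.sqrt _ => rE.
have -> : d = (a ^+ 2 - r ^+ 2) / 4 by rewrite rE; field.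
by field.
Qed.

(** The largest eigenvalue of the quadratic form on the left is the larger root
of the characteristic polynomial given in the hypothesis. Along axis [i] the
matrix of [l |W|^2] minus the form has the diagonal entry [X], on the orthogonal
complement it is [Y] times the identity, and the off-diagonal coupling has
square [X Y]; so nonnegativity follows from the signs of [X] and [Y]. *)
Lemma transverse_form_le (c l : R) W B i :
  let a := c ^+ 2 + dotv B B in
  l ^+ 2 - a * l + c ^+ 2 * B 0 i ^+ 2 = 0 -> a <= 2 * l ->
  c ^+ 2 * W 0 i ^+ 2
  + dotv (W 0 i *: B - B 0 i *: W) (W 0 i *: B - B 0 i *: W) <= l * dotv W W.
Proof.
move=> a lroot la.
have := cauchy_schwarz_perp W B i.
have := coord_sqr_le W i; have := coord_sqr_le B i.
rewrite !dotv_linE (dotvC B W).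
move: lroot la; rewrite {}/a.
set x := W 0 i; set y := B 0 i; set t := dotv W B.
set M := dotv W W; set N := dotv B B => lroot la yN xM CS.
pose X := l - c ^+ 2 - (N - y ^+ 2); pose Y := l - y ^+ 2.
have XY : X * Y = y ^+ 2 * (N - y ^+ 2).
  by apply/eqP; rewrite -subr_eq0 -lroot /X /Y; apply/eqP; ring.
(* X and Y have the same sign, and their sum 2 l - a is nonnegative *)
have XYge0 : 0 <= X * Y by rewrite XY mulr_ge0 ?sqr_ge0 ?subr_ge0.
have XYsum : 0 <= X + Y by rewrite /X /Y; lra.
have X0 : 0 <= X by nra.
have Y0 : 0 <= Y by nra.
(* the coupling term, by Cauchy-Schwarz and then the AM-GM inequality *)
have key : `|2 * (x * y * (t - x * y))| <= X * x ^+ 2 + Y * (M - x ^+ 2).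
  apply: ler_norm_sqr.
    by apply: addr_ge0; apply: mulr_ge0; rewrite ?sqr_ge0 // subr_ge0.
  have h1 : x ^+ 2 * y ^+ 2 * (t - x * y) ^+ 2
            <= x ^+ 2 * y ^+ 2 * ((M - x ^+ 2) * (N - y ^+ 2)).
    by rewrite ler_wpM2l // mulr_ge0 ?sqr_ge0.
  have h2 : x ^+ 2 * y ^+ 2 * ((M - x ^+ 2) * (N - y ^+ 2))
            = (X * x ^+ 2) * (Y * (M - x ^+ 2)).
    transitivity (y ^+ 2 * (N - y ^+ 2) * (x ^+ 2 * (M - x ^+ 2))); first by ring.
    by rewrite -XY; ring.
  have h3 := sqr_ge0 (X * x ^+ 2 - Y * (M - x ^+ 2)).
  move: h1 h3; rewrite h2; set P := X * _; set S := Y * _ => h1 h3.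
  rewrite !exprMn -mulrA; nra.
have := le_trans (ler_normN _) key.
rewrite /X /Y; nra.
Qed.

(** The left side is the inner product of [(s, b)] with [(c W_i, q)], where
[q = W_i B - B_i W]. Completing squares bounds [2 C] times it by
[C^2 |(s, b)|^2 + |(c W_i, q)|^2], and the last square is at most [C^2 |W|^2] by
[transverse_form_le]. *)
Lemma fast_form_le (c C s : R) W B b i : 0 < c ->
  let a := c ^+ 2 + dotv B B in
  C = (Num.sqrt 2)^-1 *
      Num.sqrt (a + Num.sqrt (a ^+ 2 - 4 * (c ^+ 2 * B 0 i ^+ 2))) ->
  c * s * W 0 i + W 0 i * dotv B b - B 0 i * dotv W b
  <= C * ((dotv b b + dotv W W + s ^+ 2) / 2).
Proof.
move=> c0 a CE.
have c2 : 0 < c ^+ 2 by rewrite exprn_gt0.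
have yN := coord_sqr_le B i.
have a0 : 0 < a by rewrite ltr_pwDl // dotv_ge0.
have disc : 0 <= a ^+ 2 - 4 * (c ^+ 2 * B 0 i ^+ 2).
  have := sqr_ge0 (c ^+ 2 - B 0 i ^+ 2); have := sqr_ge0 (B 0 i).
  rewrite {}/a in CE a0 *; nra.
have rad0 : 0 < a + Num.sqrt (a ^+ 2 - 4 * (c ^+ 2 * B 0 i ^+ 2)).
  by rewrite ltr_pwDl ?sqrtr_ge0.
have C0 : 0 < C by rewrite CE mulr_gt0 ?invr_gt0 ?sqrtr_gt0.
have lE : C ^+ 2 = (a + Num.sqrt (a ^+ 2 - 4 * (c ^+ 2 * B 0 i ^+ 2))) / 2.
  by rewrite CE exprMn exprVn !sqr_sqrtr ?(ltW rad0) // mulrC.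
have [lroot la] := larger_root _ _ _ disc lE.
have := transverse_form_le c (C ^+ 2) W B i lroot la.
set q := W 0 i *: B - B 0 i *: W => form_le.
have -> : c * s * W 0 i + W 0 i * dotv B b - B 0 i * dotv W b
          = c * s * W 0 i + dotv b q.
  by rewrite /q !dotv_linE !(dotvC b); ring.
clearbody q.
have sq1 := sqr_ge0 (C * s - c * W 0 i).
have sq2 := dotv_ge0 (C *: b - q).
rewrite -(ler_pM2l C0).
rewrite !dotv_linE (dotvC q b) in sq2.
nra.
Qed.

End FastSpeed.

(** * The energy relative to a fixed velocity and field *)

Section RelativeEnergy.
Context {R : realType}.
Implicit Types (U V : state R) (v B : 'rV[R]_3).

(** The inner product of [U] with the vector [(|v|^2/2, -v, -B, 1)]. *)
Definition relative_energy v B U : R :=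
  density U * (dotv v v / 2) - dotv v (momentum U) - dotv B (magnetic U)
  + energy U.

Lemma density_is_linear : linear (@density R : state R -> R^o).
Proof. by move=> a U V; rewrite /density linearP !mxE. Qed.

HB.instance Definition _ :=
  GRing.isLinear.Build R (state R) R^o *:%R (@density R) density_is_linear.

Lemma relative_energy_is_linear v B :
  linear (relative_energy v B : state R -> R^o).
Proof.
move=> a U V; rewrite /relative_energy density_is_linear.
rewrite /momentum /magnetic /energy !linearP !mxE.
by rewrite /GRing.scale /=; ring.
Qed.

HB.instance Definition _ v B :=
  GRing.isLinear.Build R (state R) R^o *:%R (relative_energy v B)
    (relative_energy_is_linear v B).

Lemma relative_energyE v B U : density U != 0 ->
  relative_energy v B U + dotv B B / 2 =
  (density U * dotv (velocity U - v) (velocity U - v)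
   + dotv (magnetic U - B) (magnetic U - B)) / 2 + internal_energy U.
Proof.
move=> rn0; rewrite /relative_energy /internal_energy /velocity !enorm_sqr.
rewrite !dotv_linE !(dotvC (momentum U) v) !(dotvC (magnetic U) B).
by field.
Qed.

Lemma internal_energyE U : density U != 0 ->
  internal_energy U =
  relative_energy (velocity U) (magnetic U) U
  + dotv (magnetic U) (magnetic U) / 2.
Proof.
by move=> rn0; rewrite relative_energyE // !subrr !raddf0 mulr0 addr0 mul0r add0r.
Qed.

Lemma relative_energy_gt0 v B U : admissible U ->
  0 < relative_energy v B U + dotv B B / 2.
Proof.
move=> [r0 e0]; rewrite relative_energyE ?gt_eqF // ltr_wpDl //.
by rewrite divr_ge0 // addr_ge0 ?dotv_ge0 // mulr_ge0 ?dotv_ge0 // ltW.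
Qed.

End RelativeEnergy.

(** * The Lax-Friedrichs pair in one direction *)

Section Splitting.
Context {R : realType} (p : R -> R -> R).
Implicit Types (U V : state R) (v B : 'rV[R]_3) (i : 'I_3).

(** What remains of [relative_energy_flux] once the terms carried by a velocity
are set apart: the work of the pressure and of the Maxwell stress against the
relative velocity. *)
Definition acoustic_work i v B U : R :=
  let w := velocity U - v in
  let b := magnetic U - B in
  pressure p U * w 0 i + w 0 i * dotv (magnetic U) b
  - magnetic U 0 i * dotv w b.

(** The point of the grouping is that the first two terms on the right depend on
[U] only through [B_i], and that [v] multiplies the magnetic part of the theta
while the fluid velocity multiplies the rest. *)
Lemma relative_energy_flux i v B U : density U != 0 ->
  relative_energy v B (flux p i U) =
  magnetic U 0 i * dotv v B - v 0 i * (dotv B B / 2)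
  + velocity U 0 i *
    (relative_energy v B U + dotv B B / 2
     - dotv (magnetic U - B) (magnetic U - B) / 2)
  + v 0 i * (dotv (magnetic U - B) (magnetic U - B) / 2)
  + acoustic_work i v B U.
Proof.
move=> rn0; rewrite /acoustic_work /relative_energy /flux.
rewrite density_mkstate momentum_mkstate magnetic_mkstate energy_mkstate.
have -> : momentum U = density U *: velocity U.
  by rewrite /velocity scalerA mulfV ?scale1r.
rewrite /total_pressure enorm_sqr.
move: (velocity U) (magnetic U) => u b.
rewrite !dotv_linE !dotv_delta !mxE.
rewrite (dotvC B b) (dotvC v u) (dotvC v b) (dotvC B u).
by field.
Qed.

Lemma fast_speed_ge0 i U : 0 <= fast_speed p i U.
Proof. by rewrite mulr_ge0 ?invr_ge0 ?sqrtr_ge0. Qed.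

(** In the variables [W = sqrt rho w], [B / sqrt rho], [b] and [sqrt (2 e)
sqrt rho] this is [fast_form_le], since [p = C_s rho sqrt (2 e)] and theta is
half the sum of the squares of [W], [b] and the last variable. Reversing
[b] and the last variable changes the sign of the work but not theta, whence the
absolute value. *)
Lemma acoustic_work_le i v B U : valid_eos p -> admissible U ->
  `|acoustic_work i v B U|
  <= fast_speed p i U * (relative_energy v B U + dotv B B / 2).
Proof.
move=> hp [r0 e0]; rewrite relative_energyE ?gt_eqF //.
have e1 : 0 < specific_energy U by rewrite divr_gt0.
have p0 : 0 < pressure p U by exact: (proj1 (hp _ _ r0) e1).
pose r := Num.sqrt (density U); pose s := Num.sqrt (2 * specific_energy U).
have rr : r ^+ 2 = density U by rewrite sqr_sqrtr ?ltW.
have ss : s ^+ 2 = 2 * specific_energy U by rewrite sqr_sqrtr // mulr_ge0 // ltW.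
have r1 : 0 < r by rewrite sqrtr_gt0.
have s1 : 0 < s by rewrite sqrtr_gt0 mulr_gt0.
have c0 : 0 < sound_speed p U by rewrite divr_gt0 // mulr_gt0.
have pE : pressure p U = sound_speed p U * (density U * s).
  by rewrite /sound_speed -/s divfK // gt_eqF // mulr_gt0.
have BB : dotv (r^-1 *: magnetic U) (r^-1 *: magnetic U)
          = enorm (magnetic U) ^+ 2 / density U.
  by rewrite enorm_sqr !dotv_linE -rr; field; rewrite gt_eqF.
have Bi : (sound_speed p U) ^+ 2 * (r^-1 *: magnetic U) 0 i ^+ 2
          = sound_speed p U ^+ 2 * magnetic U 0 i ^+ 2 / density U.
  by rewrite mxE -rr; field; rewrite gt_eqF.
(* t is the sign 1 or -1 *)
have bound (t : R) (w b : 'rV[R]_3) : t ^+ 2 = 1 ->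
    t * (pressure p U * w 0 i + w 0 i * dotv (magnetic U) b
         - magnetic U 0 i * dotv w b)
    <= fast_speed p i U
       * ((density U * dotv w w + dotv b b) / 2 + internal_energy U).
  move=> t1.
  have := fast_form_le (sound_speed p U) (fast_speed p i U) (t * (r * s))
    (r *: w) (r^-1 *: magnetic U) (t *: b) i c0.
  rewrite BB Bi => /(_ erefl).
  rewrite !dotv_linE [(r *: w) 0 i]mxE [(r^-1 *: magnetic U) 0 i]mxE.
  apply: eq_ind; congr (_ <= _ * _).
    by rewrite pE -rr; field; rewrite gt_eqF.
  have -> : internal_energy U = density U * specific_energy U.
    by rewrite /specific_energy mulrC divfK // gt_eqF.
  rewrite !exprMn ss rr t1 [r * (r * _)]mulrA [t * (t * _)]mulrA.
  rewrite -!expr2 rr t1.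
  by field.
rewrite ler_norml; apply/andP; split.
  rewrite lerNl -mulN1r; apply: bound.
  by rewrite sqrrN expr1n.
by rewrite -[leLHS]mul1r; apply: bound; rewrite expr1n.
Qed.

(** The two factors on the left are, up to the factor 1/2, a combination [X] of
relative velocities and the inner product [Y] of the field jump with a sum of
relative fields. Cauchy-Schwarz bounds [X^2] by the kinetic parts [K] of the
thetas and [Y^2] by their magnetic parts [H]; then [sqrt (K H) <= (K + H)/2]. *)
Lemma magnetic_jump_le i v B U V (s : R) : admissible U -> admissible V ->
  (s * velocity U 0 i + (1 - s) * velocity V 0 i - v 0 i)
  * ((dotv (magnetic V - B) (magnetic V - B)
      - dotv (magnetic U - B) (magnetic U - B)) / 2)
  <= enorm (magnetic V - magnetic U) / Num.sqrt 2
     * Num.sqrt (s ^+ 2 / density U + (1 - s) ^+ 2 / density V)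
     * (relative_energy v B U + dotv B B / 2
        + (relative_energy v B V + dotv B B / 2)).
Proof.
move=> [rU eU] [rV eV]; rewrite !relative_energyE ?gt_eqF //.
set wU := velocity U - v; set wV := velocity V - v.
set bU := magnetic U - B; set bV := magnetic V - B.
set S := s ^+ 2 / _ + _; set D := enorm _.
have S0 : 0 <= S by rewrite addr_ge0 // divr_ge0 ?sqr_ge0 // ltW.
pose X := s * wU 0 i + (1 - s) * wV 0 i.
have -> : s * velocity U 0 i + (1 - s) * velocity V 0 i - v 0 i = X.
  by rewrite /X !mxE; ring.
have jumpE : magnetic V - magnetic U = bV - bU.
  by rewrite /bU /bV opprB addrA subrK.
clearbody wU wV bU bV.
pose Y := dotv (magnetic V - magnetic U) (bU + bV).
have -> : dotv bV bV - dotv bU bU = Y.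
  by rewrite /Y jumpE !dotv_linE (dotvC bU bV); ring.
pose K := density U * dotv wU wU + density V * dotv wV wV.
pose H := dotv bU bU + dotv bV bV.
have K0 : 0 <= K by rewrite addr_ge0 // mulr_ge0 ?dotv_ge0 // ltW.
have H0 : 0 <= H by rewrite addr_ge0 ?dotv_ge0.
(* Cauchy-Schwarz with weights rho; the defect is an explicit square *)
have X2 : X ^+ 2 <= S * K.
  have hU := coord_sqr_le wU i; have hV := coord_sqr_le wV i.
  have : X ^+ 2 <= S * (density U * wU 0 i ^+ 2 + density V * wV 0 i ^+ 2).
    rewrite -subr_ge0.
    have -> : S * (density U * wU 0 i ^+ 2 + density V * wV 0 i ^+ 2) - X ^+ 2
       = (s * density V * wV 0 i - (1 - s) * density U * wU 0 i) ^+ 2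
         / (density U * density V).
      by rewrite /S /X; field; rewrite !gt_eqF.
    by rewrite divr_ge0 ?sqr_ge0 // mulr_ge0 ?ltW.
  move=> h; apply: (le_trans h); rewrite ler_wpM2l //.
  by apply: lerD; rewrite ler_wpM2l // ltW.
have Y2 : Y ^+ 2 <= 2 * D ^+ 2 * H.
  apply: le_trans (cauchy_schwarz _ _) _.
  have -> : 2 * D ^+ 2 * H = D ^+ 2 * (2 * H) by ring.
  rewrite -enorm_sqr -/D ler_wpM2l ?sqr_ge0 //.
  have := dotv_ge0 (bU - bV).
  by rewrite /H !dotv_linE (dotvC bV bU); lra.
have D0 : 0 <= D by exact: sqrtr_ge0.
clearbody D.
have q0 : 0 < Num.sqrt 2 :> R by rewrite sqrtr_gt0.
have q2 : Num.sqrt 2 ^+ 2 = 2 :> R by rewrite sqr_sqrtr.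
have DS0 : 0 <= D / Num.sqrt 2 * Num.sqrt S.
  by rewrite mulr_ge0 ?sqrtr_ge0 // divr_ge0 // ltW.
have main : `|X * (Y / 2)| <= D / Num.sqrt 2 * Num.sqrt S * ((K + H) / 2).
  apply: ler_norm_sqr.
    by rewrite mulr_ge0 // divr_ge0 // addr_ge0.
  have XY : X ^+ 2 * Y ^+ 2 <= S * K * (2 * D ^+ 2 * H).
    by rewrite ler_pM ?sqr_ge0.
  rewrite !exprMn !exprVn q2 sqr_sqrtr //.
  have DS : 0 <= D ^+ 2 * S by rewrite mulr_ge0 ?sqr_ge0.
  rewrite -subr_ge0.
  have -> : D ^+ 2 / 2 * S * ((K + H) ^+ 2 / 2 ^+ 2) - X ^+ 2 * (Y ^+ 2 / 2 ^+ 2)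
    = D ^+ 2 * S * (K - H) ^+ 2 / 8
      + (S * K * (2 * D ^+ 2 * H) - X ^+ 2 * Y ^+ 2) / 4 by field.
  by rewrite addr_ge0 // divr_ge0 // ?subr_ge0 // mulr_ge0 ?sqr_ge0.
apply: le_trans (ler_norm _) (le_trans main _).
rewrite ler_wpM2l //.
by rewrite /K /H; lra.
Qed.

(** The thetas of the two states control every term of the flux difference
except the one in [v . B], at the exact cost [alpha_at]. *)
Lemma flux_difference_le i v B U V (s : R) :
  valid_eos p -> admissible U -> admissible V ->
  relative_energy v B (flux p i U) - relative_energy v B (flux p i V)
  - (magnetic U 0 i - magnetic V 0 i) * dotv v B
  <= alpha_at p i U V s * (relative_energy v B U + dotv B B / 2
                           + (relative_energy v B V + dotv B B / 2)).
Proof.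
move=> hp aU aV.
have jump := magnetic_jump_le i v B U V s aU aV.
have workU := acoustic_work_le i v B U hp aU.
have workV := acoustic_work_le i v B V hp aV.
have thU := relative_energy_gt0 v B U aU.
have thV := relative_energy_gt0 v B V aV.
have hU : dotv (magnetic U - B) (magnetic U - B) / 2
          <= relative_energy v B U + dotv B B / 2.
  case: (aU) => r0 e0; rewrite relative_energyE ?gt_eqF //.
  have := mulr_ge0 (ltW r0) (dotv_ge0 (velocity U - v)); lra.
have hV : dotv (magnetic V - B) (magnetic V - B) / 2
          <= relative_energy v B V + dotv B B / 2.
  case: (aV) => r0 e0; rewrite relative_energyE ?gt_eqF //.
  have := mulr_ge0 (ltW r0) (dotv_ge0 (velocity V - v)); lra.
have bU := dotv_ge0 (magnetic U - B); have bV := dotv_ge0 (magnetic V - B).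
have rU : density U != 0 by case: aU => r0 _; rewrite gt_eqF.
have rV : density V != 0 by case: aV => r0 _; rewrite gt_eqF.
rewrite !relative_energy_flux //.
move: jump; rewrite /alpha_at /=.
set a := Num.max _ _; set jmp := _ * Num.sqrt _.
set ThU := _ + dotv B B / 2 in thU hU workU *.
set ThV := relative_energy v B V + _ in thV hV workV *.
set qU := dotv (magnetic U - B) _ in hU bU *.
set qV := dotv (magnetic V - B) _ in hV bV *.
set sg := s * _ + (1 - s) * _ in a *.
(* a dominates the speed of the fluid part and that of the magnetic part *)
have aU1 : `|velocity U 0 i| + fast_speed p i U <= a by rewrite le_max lexx.
have aV1 : `|velocity V 0 i| + fast_speed p i V <= a by rewrite !le_max lexx !orbT.
have aU2 : `|sg| + fast_speed p i U <= a.
  by rewrite !le_max lerD2l le_max lexx !orbT.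
have aV2 : `|sg| + fast_speed p i V <= a.
  by rewrite !le_max lerD2l le_max lexx !orbT.
(* theta is the fluid part Th - q/2 plus the magnetic part q/2, each
   transported at its own speed *)
have one (x C Th q work : R) : 0 <= q -> q / 2 <= Th -> x + C <= a ->
    `|sg| + C <= a -> work <= C * Th ->
    x * (Th - q / 2) + `|sg| * (q / 2) + work <= a * Th.
  nra.
have hU1 := one _ _ ThU qU _ bU hU aU1 aU2 (le_trans (ler_norm _) workU).
have hV1 := one _ _ ThV qV _ bV hV aV1 aV2 (le_trans (ler_normN _) workV).
have n1 := ler_norm (velocity U 0 i).
have n2 := ler_normN (velocity V 0 i).
have n3 := ler_norm sg.
have n4 := ler_normN sg.
have m1 : velocity U 0 i * (ThU - qU / 2) <= `|velocity U 0 i| * (ThU - qU / 2).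
  by rewrite ler_wpM2r ?subr_ge0.
have m2 : - velocity V 0 i * (ThV - qV / 2) <= `|velocity V 0 i| * (ThV - qV / 2).
  by rewrite ler_wpM2r ?subr_ge0.
have m3 : sg * (qU / 2) <= `|sg| * (qU / 2) by rewrite ler_wpM2r ?divr_ge0.
have m4 : - sg * (qV / 2) <= `|sg| * (qV / 2) by rewrite ler_wpM2r ?divr_ge0.
move=> jump; lra.
Qed.

Lemma alpha_gt_velocity i U V a : admissible U -> admissible V ->
  alpha p i U V < a -> `|velocity U 0 i| < a /\ `|velocity V 0 i| < a.
Proof.
move=> aU aV; have [s [-> _]] := alpha_attained p i aU aV => ha.
have jump : 0 <= enorm (magnetic V - magnetic U) / Num.sqrt 2
    * Num.sqrt (s ^+ 2 / density U + (1 - s) ^+ 2 / density V).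
  by rewrite !mulr_ge0 ?invr_ge0 ?sqrtr_ge0.
have le_a W x : x + fast_speed p i W <= alpha_at p i U V s -> x < a.
  move=> h; apply: le_lt_trans ha; apply: le_trans h.
  by rewrite lerDl fast_speed_ge0.
split; [apply: (le_a U)|apply: (le_a V)]; rewrite /alpha_at /= -[leLHS]addr0;
  by rewrite lerD // !le_max lexx ?orbT.
Qed.

Lemma alpha_gt_gt0 i U V a : admissible U -> admissible V ->
  alpha p i U V < a -> 0 < a.
Proof.
by move=> aU aV /(alpha_gt_velocity i U V a aU aV)[vU _]; apply: le_lt_trans vU.
Qed.

Definition lf_pair i (a : R) U V : state R :=
  U - a^-1 *: flux p i U + V + a^-1 *: flux p i V.

Lemma linear_lf_pair (f : {linear state R -> R^o}) i a U V :
  f (lf_pair i a U V)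
  = f U - a^-1 * f (flux p i U) + f V + a^-1 * f (flux p i V) :> R.
Proof. by rewrite /lf_pair !linearD linearN !linearZ. Qed.

Lemma density_lf_pair_gt0 i a U V : admissible U -> admissible V ->
  alpha p i U V < a -> 0 < density (lf_pair i a U V).
Proof.
move=> aU aV /(alpha_gt_velocity i U V a aU aV) [vU vV].
have a0 : 0 < a by apply: le_lt_trans vU.
case: aU aV => rU _ [rV _].
rewrite (linear_lf_pair (@density R)) /= !density_mkstate.
have -> : density U - a^-1 * (density U * velocity U 0 i) + density V
            + a^-1 * (density V * velocity V 0 i)
  = density U * (1 - velocity U 0 i / a) + density V * (1 + velocity V 0 i / a).
  by ring.
rewrite ltr_norml in vV; case/andP: vV => vV _.
rewrite ltr_norml in vU; case/andP: vU => _ vU.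
rewrite addr_gt0 // mulr_gt0 //.
  by rewrite subr_gt0 ltr_pdivrMr ?mul1r.
by rewrite -ltrBlDl sub0r ltr_pdivlMr // mulN1r.
Qed.

(** The sum of two thetas beats [a^-1] times the flux difference as soon as [a]
exceeds the minimum of [alpha_at] over its parameter; the term in [v . B] is
what the divergence-free condition must cancel later. *)
Lemma relative_energy_lf_pair_gt0 i a v B U V :
  valid_eos p -> admissible U -> admissible V -> alpha p i U V < a ->
  0 < relative_energy v B (lf_pair i a U V) + dotv B B
      + a^-1 * (magnetic U 0 i - magnetic V 0 i) * dotv v B.
Proof.
move=> hp aU aV ha; have a0 := alpha_gt_gt0 i U V a aU aV ha.
move: ha; have [s [-> _]] := alpha_attained p i aU aV => ha.
have := flux_difference_le i v B U V s hp aU aV.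
have thU := relative_energy_gt0 v B U aU.
have thV := relative_energy_gt0 v B V aV.
rewrite (linear_lf_pair (relative_energy v B)) /=.
set thetas := (X in _ <= _ * X) => difference_le.
have thetas_gt0 : 0 < thetas by rewrite addr_gt0.
have /(le_lt_trans difference_le) : alpha_at p i U V s * thetas < a * thetas.
  by rewrite ltr_pM2r.
rewrite -(pmulr_rgt0 _ a0) -subr_gt0.
by apply: eq_ind; congr (0 < _); rewrite /thetas; field; rewrite gt_eqF.
Qed.

End Splitting.

(** * Averaging over the three directions *)

Section WeightedAverages.
Context {R : realType} {Q : nat}.
Implicit Types (w f : 'I_Q -> R) (X Y Z : 'I_Q -> state R).

Lemma max_fam_lt (hQ : (1 <= Q)%N) f (a : R) i : max_fam hQ f < a -> f i < a.
Proof. by move=> /bigmax_ltP[_ /(_ i isT)]. Qed.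

Lemma weighted_sum_gt0 w f : (1 <= Q)%N -> (forall i, 0 < w i) ->
  (forall i, 0 < f i) -> 0 < \sum_(i < Q) w i * f i.
Proof.
move=> hQ w0 f0; rewrite (bigD1 (Ordinal hQ)) //= ltr_pwDl ?mulr_gt0 //.
by apply: sumr_ge0 => i _; rewrite mulr_ge0 // ltW.
Qed.

Lemma linear_average (g : {linear state R -> R^o}) (c c1 c2 c3 : R) w X Y Z :
  g (c *: \sum_(i < Q) w i *: (c1 *: X i + c2 *: Y i + c3 *: Z i))
  = c * \sum_(i < Q) w i * (c1 * g (X i) + c2 * g (Y i) + c3 * g (Z i)) :> R.
Proof.
rewrite linearZ linear_sum; congr (_ * _); apply: eq_bigr => i _.
by rewrite linearZ !linearD !linearZ.
Qed.

End WeightedAverages.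

Theorem theorem2p16 (R : realType) (p : R -> R -> R) (hp : valid_eos p)
  (Q : nat) (hQ : (1 <= Q)%N)
  (dx dy dz : R) (hdx : 0 < dx) (hdy : 0 < dy) (hdz : 0 < dz)
  (w : 'I_Q -> R) (hw : forall i, 0 < w i) (hw1 : \sum_(i < Q) w i = 1)
  (Ubar Utilde Uhat Ucheck Uacute Ugrave : 'I_Q -> state R)
  (hbar : forall i, admissible (Ubar i))
  (htilde : forall i, admissible (Utilde i))
  (hhat : forall i, admissible (Uhat i))
  (hcheck : forall i, admissible (Ucheck i))
  (hacute : forall i, admissible (Uacute i))
  (hgrave : forall i, admissible (Ugrave i))
  (hdiv :
    (\sum_(i < Q) w i * (magnetic (Ubar i) 0 axis1
                         - magnetic (Utilde i) 0 axis1)) / dx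
    + (\sum_(i < Q) w i * (magnetic (Uhat i) 0 axis2
                           - magnetic (Ucheck i) 0 axis2)) / dy
    + (\sum_(i < Q) w i * (magnetic (Uacute i) 0 axis3
                           - magnetic (Ugrave i) 0 axis3)) / dz = 0)
  (a1 a2 a3 : R)
  (ha1 : max_fam hQ (fun i => alpha p axis1 (Ubar i) (Utilde i)) < a1)
  (ha2 : max_fam hQ (fun i => alpha p axis2 (Uhat i) (Ucheck i)) < a2)
  (ha3 : max_fam hQ (fun i => alpha p axis3 (Uacute i) (Ugrave i)) < a3) :
  admissible
    ((2 * (a1 / dx + a2 / dy + a3 / dz))^-1 *:
     \sum_(i < Q) w i *:
       ((a1 / dx) *: (Ubar i - a1^-1 *: flux p axis1 (Ubar i)
                      + Utilde i + a1^-1 *: flux p axis1 (Utilde i))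
        + (a2 / dy) *: (Uhat i - a2^-1 *: flux p axis2 (Uhat i)
                        + Ucheck i + a2^-1 *: flux p axis2 (Ucheck i))
        + (a3 / dz) *: (Uacute i - a3^-1 *: flux p axis3 (Uacute i)
                        + Ugrave i + a3^-1 *: flux p axis3 (Ugrave i)))).
Proof.
have al1 i := max_fam_lt hQ _ _ i ha1.
have al2 i := max_fam_lt hQ _ _ i ha2.
have al3 i := max_fam_lt hQ _ _ i ha3.
pose i0 := Ordinal hQ.
have a1_gt0 := alpha_gt_gt0 p _ _ _ _ (hbar i0) (htilde i0) (al1 i0).
have a2_gt0 := alpha_gt_gt0 p _ _ _ _ (hhat i0) (hcheck i0) (al2 i0).
have a3_gt0 := alpha_gt_gt0 p _ _ _ _ (hacute i0) (hgrave i0) (al3 i0).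
have c1_gt0 : 0 < a1 / dx by rewrite divr_gt0.
have c2_gt0 : 0 < a2 / dy by rewrite divr_gt0.
have c3_gt0 : 0 < a3 / dz by rewrite divr_gt0.
set A := a1 / dx + a2 / dy + a3 / dz.
have A_gt0 : 0 < A by rewrite !addr_gt0.
have c_gt0 : 0 < (2 * A)^-1 by rewrite invr_gt0 mulr_gt0.
pose P1 i := lf_pair p axis1 a1 (Ubar i) (Utilde i).
pose P2 i := lf_pair p axis2 a2 (Uhat i) (Ucheck i).
pose P3 i := lf_pair p axis3 a3 (Uacute i) (Ugrave i).
set W := (2 * A)^-1 *: _.
have average (g : {linear state R -> R^o}) : g W = (2 * A)^-1 * \sum_(i < Q)
    w i * (a1 / dx * g (P1 i) + a2 / dy * g (P2 i) + a3 / dz * g (P3 i)) :> R.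
  exact: (linear_average g _ _ _ _ w P1 P2 P3).
have rho_gt0 : 0 < density W.
  rewrite (average (@density R)) mulr_gt0 // weighted_sum_gt0 // => i.
  by rewrite !addr_gt0 // mulr_gt0 // density_lf_pair_gt0.
split => //; rewrite internal_energyE ?gt_eqF //.
set v := velocity W; set B := magnetic W.
rewrite (average (relative_energy v B)) /=.
pose j1 i := magnetic (Ubar i) 0 axis1 - magnetic (Utilde i) 0 axis1.
pose j2 i := magnetic (Uhat i) 0 axis2 - magnetic (Ucheck i) 0 axis2.
pose j3 i := magnetic (Uacute i) 0 axis3 - magnetic (Ugrave i) 0 axis3.
(* the left-over terms in v.B cancel in the average *)
have jumps0 : \sum_(i < Q) w i * (j1 i / dx + j2 i / dy + j3 i / dz) = 0.
  rewrite -[RHS]hdiv !mulr_suml -!big_split; apply: eq_bigr => i _ /=.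
  by rewrite /j1 /j2 /j3; ring.
(* |B|^2/2 is an average too, so that it can be shared out as one |B|^2 for each
   pair of states *)
have half : dotv B B / 2 = (2 * A)^-1 * \sum_(i < Q) w i * (A * dotv B B).
  by rewrite -mulr_suml hw1 mul1r; field; rewrite gt_eqF.
have jump : 0 = (2 * A)^-1 * (dotv v B *
    \sum_(i < Q) w i * (j1 i / dx + j2 i / dy + j3 i / dz)).
  by rewrite jumps0 !mulr0.
rewrite -[X in _ < X]addr0 [X in _ < _ + X]jump half -!mulrDr.
rewrite [dotv v B * _]mulr_sumr -!big_split.
rewrite mulr_gt0 //=.
under eq_bigr => i _ do rewrite [dotv v B * (_ * _)]mulrCA -!mulrDr.
apply: weighted_sum_gt0 => // i.
have /(mulr_gt0 c1_gt0) h1 := relative_energy_lf_pair_gt0 p axis1 a1 v B _ _ hp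
  (hbar i) (htilde i) (al1 i).
have /(mulr_gt0 c2_gt0) h2 := relative_energy_lf_pair_gt0 p axis2 a2 v B _ _ hp
  (hhat i) (hcheck i) (al2 i).
have /(mulr_gt0 c3_gt0) h3 := relative_energy_lf_pair_gt0 p axis3 a3 v B _ _ hp
  (hacute i) (hgrave i) (al3 i).
have := addr_gt0 (addr_gt0 h1 h2) h3.
rewrite -/(j1 i) -/(j2 i) -/(j3 i) -/(P1 i) -/(P2 i) -/(P3 i).
rewrite /A; move: (relative_energy v B (P1 i)) (relative_energy v B (P2 i))
  (relative_energy v B (P3 i)) (dotv B B) (dotv v B) (j1 i) (j2 i) (j3 i).
move=> e1 e2 e3 b2 vb d1 d2 d3; apply: eq_ind; congr (0 < _).
by field; rewrite !gt_eqF.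
Qed.
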